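(* Let $A$ be a unital algebra with differential graded algebra $(\Omega,\mathrm d)$, let $E$ be an $A$-bimodule and $\sigma_E:E\otimes_A\Omega^1\to\Omega^1\otimes_AE$ a bimodule map. (1) The actions \begin{align*} a\bullet_1s&=as+\mathrm da\otimes s, & s\bullet_1a&=sa+\sigma_E(s\otimes\mathrm da),\\ a\bullet_1(\omega\otimes s)&=a\omega\otimes s, & (\omega\otimes s)\bullet_1a&=\omega\otimes sa \end{align*} for $a\in A$, $s\in E$, $\omega\in\Omega^1$, make $\mathcal J^1_E=E\oplus\Omega^1\otimes_AE$ an $A$-bimodule, and $$0\to\Omega^1\otimes_AE\to\mathcal J^1_E\to E\to0$$ (where the second map quotients out the $\Omega^1\otimes_AE$ part) is an exact sequence of bimodules. (2) Bimodule map splittings $j^1_E:E\to\mathcal J^1_E$ of this exact sequence are in one-to-one correspondence with bimodule connections $\nabla_E$ on $E$ with generalised braiding $\sigma_E$, and take the form $$j^1_E:E\to\mathcal J^1_E,\qquad j^1_E(s)=s+\nabla_Es .$$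
   Context: Everything is over a field. $A$ is a unital algebra and $(\Omega,\mathrm d)$ is a differential graded algebra with $\Omega^0=A$, with graded Leibniz rule and $\Omega$ generated by $A,\mathrm dA$; only $\Omega^1$ (an $A$-bimodule spanned by elements $a\,\mathrm db$) and the derivation $\mathrm d:A\to\Omega^1$ matter here. A bimodule connection on $E$ with generalised braiding $\sigma_E$ is a linear map $\nabla_E:E\to\Omega^1\otimes_AE$ with $\nabla_E(as)=\mathrm da\otimes s+a\nabla_Es$ and $\nabla_E(sa)=(\nabla_Es)a+\sigma_E(s\otimes\mathrm da)$ for all $a\in A$, $s\in E$. In the exact sequence $E$ and $\Omega^1\otimes_AE$ carry their given bimodule structures and $\mathcal J^1_E$ carries $\bullet_1$. *)

(* Defs.v *)
From HB Require Import structures.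
From mathcomp Require Import all_boot all_algebra.
From mathcomp Require Import boolp classical_sets functions.

Set Implicit Arguments.
Unset Strict Implicit.
Unset Printing Implicit Defensive.

Import GRing.Theory.
Local Open Scope ring_scope.
Local Open Scope quotient_scope.

(* A vector space with two operations of A, on which no axiom is imposed;
   that it is a bimodule is the proposition [is_bimodule].               *)
Record biaction (k : fieldType) (A : algType k) := Biaction {
  ba_space :> lmodType k;
  lact : A -> ba_space -> ba_space;
  ract : ba_space -> A -> ba_space
}.

Declare Scope bimodule_scope.
Delimit Scope bimodule_scope with BM.
Notation "a *> s" := (lact a s) (at level 40, left associativity)
  : bimodule_scope.
Notation "s <* a" := (ract s a) (at level 40, left associativity)
  : bimodule_scope.
Local Open Scope bimodule_scope.

(* Bilinearity over k also forces the two actions of the scalars c%:A to be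
   the scalar multiplication of the vector space.                         *)
Record is_bimodule (k : fieldType) (A : algType k) (M : biaction A) : Prop :=
  IsBimodule {
  lact_linear : forall a : A, linear (fun s : M => a *> s);
  lact_linearl : forall s : M, linear (fun a : A => a *> s);
  lact1 : forall s : M, 1 *> s = s;
  lactA : forall (a b : A) (s : M), (a * b) *> s = a *> (b *> s);
  ract_linear : forall a : A, linear (fun s : M => s <* a);
  ract_linearr : forall s : M, linear (fun a : A => s <* a);
  ract1 : forall s : M, s <* 1 = s;
  ractA : forall (s : M) (a b : A), s <* (a * b) = (s <* a) <* b;
  lractA : forall (a : A) (s : M) (b : A), (a *> s) <* b = a *> (s <* b)
}.

Record bimodule (k : fieldType) (A : algType k) := Bimodule {
  bm_biaction :> biaction A;
  bimoduleP : is_bimodule bm_biaction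
}.

Section BimoduleTheory.
Variables (k : fieldType) (A : algType k).

Lemma linear_D (U V : lmodType k) (f : U -> V) :
  linear f -> {morph f : x y / x + y}.
Proof. by move=> fl x y; have := fl 1 x y; rewrite !scale1r. Qed.

Lemma linear_Z (U V : lmodType k) (f : U -> V) :
  linear f -> forall c x, f (c *: x) = c *: f x.
Proof.
move=> fl c x.
have f0 : f 0 = 0 by apply: (addrI (f 0)); rewrite -(linear_D fl) !addr0.
by have := fl c x 0; rewrite f0 !addr0.
Qed.

Lemma scalar_lact (M : bimodule A) c (m : M) : c%:A *> m = c *: m.
Proof.
by rewrite (linear_Z (lact_linearl (bimoduleP M) m)) (lact1 (bimoduleP M)).
Qed.

Lemma scalar_ract (M : bimodule A) c (m : M) : m <* c%:A = c *: m.
Proof.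
by rewrite (linear_Z (ract_linearr (bimoduleP M) m)) (ract1 (bimoduleP M)).
Qed.

End BimoduleTheory.

Definition is_bimodule_map (k : fieldType) (A : algType k) (M N : biaction A)
    (f : M -> N) : Prop :=
  [/\ linear f,
      forall (a : A) (s : M), f (a *> s) = a *> f s
    & forall (s : M) (a : A), f (s <* a) = f s <* a].

Definition is_short_exact (k : fieldType) (A : algType k) (M N P : biaction A)
    (i : M -> N) (p : N -> P) : Prop :=
  [/\ [/\ is_bimodule M, is_bimodule N & is_bimodule P],
      is_bimodule_map i /\ is_bimodule_map p,
      injective i,
      (forall x : N, p x = 0 <-> exists w : M, i w = x)
    & (forall y : P, exists x : N, p x = y)].

Definition is_splitting (k : fieldType) (A : algType k) (N P : biaction A)
    (p : N -> P) (j : P -> N) : Prop :=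
  is_bimodule_map j /\ forall s : P, p (j s) = s.

Section TensorProduct.
Variables (k : fieldType) (A : algType k) (M N : bimodule A).

(* A sequence [:: (m1, n1); ...; (mr, nr)] stands for the formal sum
   m1 (x) n1 + ... + mr (x) nr. [tens_eq] is the congruence generated by
   commutativity, biadditivity and A-balancedness. Its quotient is the usual
   M (x)_A N; negatives exist, as (m, n) + (- m, n) = (0, n) = 0.
   The second biadditivity zero, (m, 0) = 0, is a consequence.            *)
Inductive tens_eq : seq (M * N) -> seq (M * N) -> Prop :=
| TensRefl x : tens_eq x x
| TensSym x y : tens_eq x y -> tens_eq y x
| TensTrans x y z : tens_eq x y -> tens_eq y z -> tens_eq x z
| TensCat x x' y y' : tens_eq x x' -> tens_eq y y' ->
    tens_eq (x ++ y) (x' ++ y')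
| TensC x y : tens_eq (x ++ y) (y ++ x)
| TensDl m m' n : tens_eq [:: (m + m', n)] [:: (m, n); (m', n)]
| TensDr m n n' : tens_eq [:: (m, n + n')] [:: (m, n); (m, n')]
| Tens0l n : tens_eq [:: (0, n)] [::]
| TensBal m a n : tens_eq [:: (m <* a, n)] [:: (m, a *> n)].

Definition tens_eqb (x y : seq (M * N)) : bool := `[< tens_eq x y >].

Lemma tens_eqb_refl : reflexive tens_eqb.
Proof. by move=> x; apply/asboolP; exact: TensRefl. Qed.

Lemma tens_eqb_sym : symmetric tens_eqb.
Proof.
by move=> x y; apply/idP/idP => /asboolP h; apply/asboolP; exact: TensSym.
Qed.

Lemma tens_eqb_trans : transitive tens_eqb.
Proof.
by move=> y x z /asboolP h1 /asboolP h2; apply/asboolP; exact: TensTrans h1 h2.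
Qed.

Canonical tens_equiv := EquivRel tens_eqb
  tens_eqb_refl tens_eqb_sym tens_eqb_trans.

Definition tens : Type := {eq_quot tens_equiv}.
HB.instance Definition _ : EqQuotient _ tens_equiv tens := EqQuotient.on tens.
HB.instance Definition _ := Choice.on tens.

Lemma tens_piP x y : tens_eq x y <-> \pi_tens x = \pi_tens y.
Proof.
by split=> [h|/eqmodP/asboolP //]; apply/eqmodP/asboolP.
Qed.

Lemma tens_reprP x : tens_eq (repr (\pi_tens x)) x.
Proof. by apply/tens_piP; rewrite reprK. Qed.

Definition tens_zero : tens := \pi_tens [::].
Definition tens_add (x y : tens) : tens := \pi_tens (repr x ++ repr y).

(* Locked, lest rewriting with the [_pi] lemmas see through the lifting.  *)
Fact tens_map_key : unit. Proof. by []. Qed.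
Definition tens_map (f : M -> M) (g : N -> N) : tens -> tens :=
  locked_with tens_map_key
    (fun x => \pi_tens [seq (f p.1, g p.2) | p <- repr x]).

Lemma tens_add_pi x y :
  tens_add (\pi_tens x) (\pi_tens y) = \pi_tens (x ++ y).
Proof. by apply/tens_piP; apply: TensCat; exact: tens_reprP. Qed.

Lemma tens_addC : commutative tens_add.
Proof. by move=> x y; apply/tens_piP; exact: TensC. Qed.

Lemma tens_addA : associative tens_add.
Proof.
move=> x y z; rewrite -[x]reprK -[y]reprK -[z]reprK.
move: (repr x) (repr y) (repr z) => s t u.
rewrite (tens_add_pi t u) (tens_add_pi s t).
by rewrite (tens_add_pi s) (tens_add_pi (s ++ t)) catA.
Qed.

Lemma tens_add0 : left_id tens_zero tens_add.
Proof. by move=> x; rewrite -[x]reprK tens_add_pi. Qed.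

Lemma tens_map_pi f g x :
    {morph f : m m' / m + m'} -> {morph g : n n' / n + n'} ->
    (forall m (a : A), f (m <* a) = f m <* a) ->
    (forall (a : A) n, g (a *> n) = a *> g n) ->
  tens_map f g (\pi_tens x) = \pi_tens [seq (f p.1, g p.2) | p <- x].
Proof.
move=> fD gD fr gl.
have f0 : f 0 = 0 by apply: (addrI (f 0)); rewrite -fD !addr0.
suff H y z : tens_eq y z ->
    tens_eq [seq (f p.1, g p.2) | p <- y] [seq (f p.1, g p.2) | p <- z].
  by rewrite /tens_map unlock; apply/tens_piP; apply: H; exact: tens_reprP.
elim=> {y z} [y|y z _|y z t _ h1 _|y y' z z' _ h1 _ h2|y z|m m' n|m n n'|n|
  m a n].
- exact: TensRefl.
- exact: TensSym.
- exact: TensTrans h1.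
- by rewrite !map_cat; exact: TensCat.
- by rewrite !map_cat; exact: TensC.
- by rewrite /= fD; exact: TensDl.
- by rewrite /= gD; exact: TensDr.
- by rewrite /= f0; exact: Tens0l.
- by rewrite /= fr gl; exact: TensBal.
Qed.

Definition tens_scale (c : k) : tens -> tens := tens_map (fun m => c *: m) id.
Definition tens_lact (a : A) : tens -> tens := tens_map (lact a) id.
Definition tens_ract (x : tens) (a : A) : tens :=
  tens_map id (fun n => n <* a) x.

Lemma tens_scale_pi c x :
  tens_scale c (\pi_tens x) = \pi_tens [seq (c *: p.1, p.2) | p <- x].
Proof.
apply: tens_map_pi => //= [m m'|m a]; first by rewrite scalerDr.
by rewrite (linear_Z (ract_linear (bimoduleP M) a)).
Qed.

Lemma tens_lact_pi a x :
  tens_lact a (\pi_tens x) = \pi_tens [seq (a *> p.1, p.2) | p <- x].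
Proof.
apply: tens_map_pi => //= [m m'|m b].
  by rewrite (linear_D (lact_linear (bimoduleP M) a)).
by rewrite (lractA (bimoduleP M)).
Qed.

Lemma tens_ract_pi x a :
  tens_ract (\pi_tens x) a = \pi_tens [seq (p.1, p.2 <* a) | p <- x].
Proof.
apply: tens_map_pi => //= [n n'|b n].
  by rewrite (linear_D (ract_linear (bimoduleP N) a)).
by rewrite (lractA (bimoduleP N)).
Qed.

Lemma tens_addN x : tens_add (tens_scale (-1) x) x = tens_zero.
Proof.
rewrite -[x]reprK tens_scale_pi tens_add_pi; apply/tens_piP.
elim: (repr x) => [|[m n] s IH] /=; first exact: TensRefl.
set s' := map _ s in IH *; rewrite -cat1s -(cat1s (m, n) s) catA.
have h : tens_eq [:: (-1 *: m, n); (m, n)] [::].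
  apply: TensTrans (TensSym (TensDl _ _ _)) _.
  by rewrite scaleN1r addNr; exact: Tens0l.
apply: TensTrans (TensTrans _ (TensCat h IH)) (TensRefl _).
rewrite -[[:: _; _]]/([:: (-1 *: m, n)] ++ [:: (m, n)]) -!catA.
apply: TensCat (TensRefl _) _; rewrite !catA.
by apply: TensCat (TensC _ _) (TensRefl _).
Qed.

HB.instance Definition _ := GRing.isZmodule.Build tens
  tens_addA tens_addC tens_add0 tens_addN.

Lemma tens_piD x y : \pi_tens (x ++ y) = \pi_tens x + \pi_tens y.
Proof. by rewrite -tens_add_pi. Qed.

Lemma tens_scaleA c d x : tens_scale c (tens_scale d x) = tens_scale (c * d) x.
Proof.
rewrite -[x]reprK !tens_scale_pi -map_comp; congr (\pi_tens _).
by apply: eq_map => p /=; rewrite scalerA.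
Qed.

Lemma tens_scale1 : left_id 1 tens_scale.
Proof.
move=> x; rewrite -[x]reprK tens_scale_pi; congr (\pi_tens _).
by rewrite -[RHS]map_id; apply: eq_map => -[m n] /=; rewrite scale1r.
Qed.

Lemma tens_scaleDr : right_distributive tens_scale +%R.
Proof.
move=> c x y; rewrite -[x]reprK -[y]reprK -tens_piD !tens_scale_pi map_cat.
by rewrite tens_piD.
Qed.

Lemma tens_mapDl (f g h : M -> M) s : (forall m, f m = g m + h m) ->
  \pi_tens [seq (f p.1, p.2) | p <- s] =
    \pi_tens [seq (g p.1, p.2) | p <- s] + \pi_tens [seq (h p.1, p.2) | p <- s].
Proof.
move=> fgh; elim: s => [|[m n] s IH] /=; first by rewrite [RHS]add0r.
rewrite -cat1s -(cat1s (g m, n)) -(cat1s (h m, n)) !tens_piD IH addrACA.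
by congr (_ + _); rewrite fgh -tens_piD; apply/tens_piP; exact: TensDl.
Qed.

Lemma tens_mapDr (f g h : N -> N) s : (forall m, f m = g m + h m) ->
  \pi_tens [seq (p.1, f p.2) | p <- s] =
    \pi_tens [seq (p.1, g p.2) | p <- s] + \pi_tens [seq (p.1, h p.2) | p <- s].
Proof.
move=> fgh; elim: s => [|[m n] s IH] /=; first by rewrite [RHS]add0r.
rewrite -cat1s -(cat1s (m, g n)) -(cat1s (m, h n)) !tens_piD IH addrACA.
by congr (_ + _); rewrite fgh -tens_piD; apply/tens_piP; exact: TensDr.
Qed.

Lemma tens_scaleDl x : {morph tens_scale^~ x : c d / c + d}.
Proof.
move=> c d /=; rewrite -[x]reprK !tens_scale_pi.
by apply: tens_mapDl => m; rewrite scalerDl.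
Qed.

HB.instance Definition _ := GRing.Zmodule_isLmodule.Build k tens
  tens_scaleA tens_scale1 tens_scaleDr tens_scaleDl.

Definition tensor_biaction : biaction A :=
  @Biaction k A tens tens_lact tens_ract.

Lemma tens_scale_pir c x :
  c *: \pi_tens x = \pi_tens [seq (p.1, c *: p.2) | p <- x].
Proof.
rewrite [LHS]tens_scale_pi; elim: x => [//|[m n] s IH] /=.
rewrite -cat1s -(cat1s (m, c *: n)) !tens_piD IH; congr (_ + _).
apply/tens_piP; rewrite -(scalar_ract c m) -(scalar_lact c n); exact: TensBal.
Qed.

Lemma tensor_is_bimodule : is_bimodule tensor_biaction.
Proof.
have lin (U V : lmodType k) (f : U -> V) : {morph f : u v / u + v} ->
    (forall c u, f (c *: u) = c *: f u) -> linear f.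
  by move=> fD fZ c u v; rewrite fD fZ.
split=> /=.
- move=> a; apply: lin => [x y|c x].
    rewrite -[x]reprK -[y]reprK -tens_piD !tens_lact_pi map_cat.
    by rewrite tens_piD.
  rewrite -[x]reprK [_ *: _]tens_scale_pi !tens_lact_pi [RHS]tens_scale_pi.
  rewrite -!map_comp; congr (\pi_tens _); apply: eq_map => p /=.
  by rewrite (linear_Z (lact_linear (bimoduleP M) a)).
- move=> x; apply: lin => [a b|c a]; rewrite -[x]reprK !tens_lact_pi.
    apply: tens_mapDl => m.
    by rewrite (linear_D (lact_linearl (bimoduleP M) m)).
  rewrite [RHS]tens_scale_pi -map_comp; congr (\pi_tens _).
  apply: eq_map => p /=.
  by rewrite (linear_Z (lact_linearl (bimoduleP M) _)).
- move=> x; rewrite -[x]reprK tens_lact_pi; congr (\pi_tens _).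
  rewrite -[RHS]map_id; apply: eq_map => -[m n] /=.
  by rewrite (lact1 (bimoduleP M)).
- move=> a b x; rewrite -[x]reprK !tens_lact_pi -map_comp.
  congr (\pi_tens _); apply: eq_map => p /=.
  by rewrite (lactA (bimoduleP M)).
- move=> a; apply: lin => [x y|c x].
    rewrite -[x]reprK -[y]reprK -tens_piD !tens_ract_pi map_cat.
    by rewrite tens_piD.
  rewrite -[x]reprK [_ *: _]tens_scale_pi !tens_ract_pi [RHS]tens_scale_pi.
  by rewrite -!map_comp.
- move=> x; apply: lin => [a b|c a]; rewrite -[x]reprK !tens_ract_pi.
    have := @tens_mapDr (fun n => n <* (a + b)) (fun n => n <* a)
      (fun n => n <* b) (repr x).
    by apply=> m; rewrite (linear_D (ract_linearr (bimoduleP N) m)).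
  rewrite tens_scale_pir -map_comp; congr (\pi_tens _).
  apply: eq_map => p /=.
  by rewrite (linear_Z (ract_linearr (bimoduleP N) _)).
- move=> x; rewrite -[x]reprK tens_ract_pi; congr (\pi_tens _).
  rewrite -[RHS]map_id; apply: eq_map => -[m n] /=.
  by rewrite (ract1 (bimoduleP N)).
- move=> x a b; rewrite -[x]reprK !tens_ract_pi -map_comp.
  congr (\pi_tens _); apply: eq_map => p /=.
  by rewrite (ractA (bimoduleP N)).
- move=> a x b; rewrite -[x]reprK tens_lact_pi !tens_ract_pi tens_lact_pi.
  by rewrite -!map_comp.
Qed.

Definition tensor : bimodule A := Bimodule tensor_is_bimodule.

Definition tmul (m : M) (n : N) : tensor := \pi_tens [:: (m, n)].

Lemma tmulDl m m' n : tmul (m + m') n = tmul m n + tmul m' n.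
Proof. by rewrite -[RHS]tens_piD; apply/tens_piP; exact: TensDl. Qed.

Lemma tmulDr m n n' : tmul m (n + n') = tmul m n + tmul m n'.
Proof. by rewrite -[RHS]tens_piD; apply/tens_piP; exact: TensDr. Qed.

Lemma tmul_balanced m (a : A) n : tmul (m <* a) n = tmul m (a *> n).
Proof. by apply/tens_piP; exact: TensBal. Qed.

Lemma tmulZl c m n : tmul (c *: m) n = c *: tmul m n.
Proof. by rewrite [RHS]tens_scale_pi. Qed.

Lemma tmulZr c m n : tmul m (c *: n) = c *: tmul m n.
Proof. by rewrite [RHS]tens_scale_pir. Qed.

Lemma lact_tmul (a : A) m n : a *> tmul m n = tmul (a *> m) n.
Proof. by rewrite [LHS]tens_lact_pi. Qed.

Lemma ract_tmul m n (a : A) : tmul m n <* a = tmul m (n <* a).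
Proof. by rewrite [LHS]tens_ract_pi. Qed.

Lemma tensor_sum (x : tensor) :
  exists s : seq (M * N), x = \sum_(p <- s) tmul p.1 p.2.
Proof.
exists (repr x); rewrite -[LHS]reprK; elim: (repr x) => [|[m n] s IH].
  by rewrite big_nil.
by rewrite big_cons -IH -cat1s tens_piD.
Qed.

(* Universal property; uniqueness follows from [tensor_sum].              *)
Lemma tensor_lift (V : zmodType) (f : M -> N -> V) :
    (forall m m' n, f (m + m') n = f m n + f m' n) ->
    (forall m n n', f m (n + n') = f m n + f m n') ->
    (forall m (a : A) n, f (m <* a) n = f m (a *> n)) ->
  exists F : tensor -> V, {morph F : x y / x + y} /\
    forall m n, F (tmul m n) = f m n.
Proof.
move=> fDl fDr fb.
pose G (s : seq (M * N)) := \sum_(p <- s) f p.1 p.2.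
have GP x y : tens_eq x y -> G x = G y.
  elim=> {x y} //.
  - by move=> x y z _ -> _ ->.
  - by move=> x x' y y' _ h _ h'; rewrite /G !big_cat /=; congr (_ + _).
  - by move=> x y; rewrite /G !big_cat /= addrC.
  - by move=> m m' n; rewrite /G !big_cons !big_nil !addr0 fDl.
  - by move=> m n n'; rewrite /G !big_cons !big_nil !addr0 fDr.
  - move=> n; rewrite /G !big_cons !big_nil addr0.
    by apply: (addrI (f 0 n)); rewrite -fDl !addr0.
  - by move=> m a n; rewrite /G !big_cons !big_nil fb.
exists (fun x => G (repr x)); split=> [x y|m n].
  rewrite -{1}[x]reprK -{1}[y]reprK -tens_piD (GP _ _ (tens_reprP _)).
  by rewrite /G big_cat.
by rewrite (GP _ _ (tens_reprP _)) /G big_cons big_nil addr0.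
Qed.

End TensorProduct.

Arguments tmul {k A M N} m n.

(* The graded algebra is given as its total algebra, the internal direct sum
   of the subspaces [dg_deg n]; [dg_inj] identifies A with degree zero.   *)
Record dga (k : fieldType) (A : algType k) := DGA {
  dg_alg :> algType k;
  dg_deg : nat -> submodClosed dg_alg;
  dg_inj : {lrmorphism A -> dg_alg};
  dg_d : {linear dg_alg -> dg_alg};
  dg_sum : forall x : dg_alg, exists (n : nat) (u : nat -> dg_alg),
    (forall i, u i \in dg_deg i) /\ x = \sum_(i < n) u i;
  dg_direct : forall (n : nat) (u : nat -> dg_alg),
    (forall i, u i \in dg_deg i) -> \sum_(i < n) u i = 0 ->
    forall i, (i < n)%N -> u i = 0;
  dg_mul : forall (m n : nat) (x y : dg_alg),
    x \in dg_deg m -> y \in dg_deg n -> x * y \in dg_deg (m + n)%N;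
  dg_inj_injective : injective dg_inj;
  dg_deg0 : forall x : dg_alg, x \in dg_deg 0%N <-> exists a, dg_inj a = x;
  dg_d_deg : forall (n : nat) (x : dg_alg),
    x \in dg_deg n -> dg_d x \in dg_deg n.+1;
  dg_dd : forall x : dg_alg, dg_d (dg_d x) = 0;
  dg_leibniz : forall (n : nat) (x y : dg_alg), x \in dg_deg n ->
    dg_d (x * y) = dg_d x * y + (-1) ^+ n * (x * dg_d y);
  dg_generated : forall S : {pred dg_alg}, subalg_closed S ->
    (forall a, dg_inj a \in S) -> (forall a, dg_d (dg_inj a) \in S) ->
    forall x, x \in S
}.

Section OneForms.
Variables (k : fieldType) (A : algType k) (D : dga A).

Record one_form := OneForm {
  of_val : D;
  of_valP : of_val \in dg_deg D 1%N
}.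

HB.instance Definition _ := [isSub for of_val].
HB.instance Definition _ := [Choice of one_form by <:].
HB.instance Definition _ := [SubChoice_isSubLmodule of one_form by <:].

Lemma of_val_linear : linear of_val.
Proof. exact: (linearP (val : one_form -> D)). Qed.

Lemma of_lact_subproof (a : A) (w : one_form) :
  dg_inj D a * of_val w \in dg_deg D 1%N.
Proof.
by apply: (@dg_mul _ _ D 0%N 1%N) (of_valP w); apply/dg_deg0; exists a.
Qed.

Lemma of_ract_subproof (w : one_form) (a : A) :
  of_val w * dg_inj D a \in dg_deg D 1%N.
Proof.
by rewrite -[1%N]addn0; apply: dg_mul (of_valP w) _; apply/dg_deg0; exists a.
Qed.

Lemma of_d_subproof (a : A) : dg_d D (dg_inj D a) \in dg_deg D 1%N.
Proof. by apply: dg_d_deg; apply/dg_deg0; exists a. Qed.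

Definition of_lact (a : A) (w : one_form) : one_form :=
  OneForm (of_lact_subproof a w).
Definition of_ract (w : one_form) (a : A) : one_form :=
  OneForm (of_ract_subproof w a).

Definition one_form_biaction : biaction A := Biaction of_lact of_ract.

Lemma one_form_is_bimodule : is_bimodule one_form_biaction.
Proof.
have vl := of_val_linear; have vi := val_inj : injective of_val.
have El a w : of_val (of_lact a w) = dg_inj D a * of_val w by [].
have Er w a : of_val (of_ract w a) = of_val w * dg_inj D a by [].
split.
- move=> a c u v; apply: vi.
  by rewrite [LHS]El (vl c u v) [RHS]vl !El mulrDr scalerAr.
- move=> u c a b; apply: vi.
  by rewrite [LHS]El linearP [RHS]vl !El mulrDl scalerAl.
- by move=> u; apply: vi; rewrite [LHS]El rmorph1 mul1r.
- by move=> a b u; apply: vi; rewrite [LHS]El [RHS]El El rmorphM mulrA.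
- move=> a c u v; apply: vi.
  by rewrite [LHS]Er (vl c u v) [RHS]vl !Er mulrDl scalerAl.
- move=> u c a b; apply: vi.
  by rewrite [LHS]Er linearP [RHS]vl !Er mulrDr scalerAr.
- by move=> u; apply: vi; rewrite [LHS]Er rmorph1 mulr1.
- by move=> u a b; apply: vi; rewrite [LHS]Er [RHS]Er Er rmorphM mulrA.
- by move=> a u b; apply: vi; rewrite [LHS]Er [RHS]El El Er mulrA.
Qed.

Definition Omega1 : bimodule A := Bimodule one_form_is_bimodule.

Definition dga_d (a : A) : Omega1 := OneForm (of_d_subproof a).

End OneForms.

Section Jets.
Variables (k : fieldType) (A : algType k) (D : dga A) (E : bimodule A).
Variable sigma : tensor E (Omega1 D) -> tensor (Omega1 D) E.

Definition is_bimodule_connection (nabla : E -> tensor (Omega1 D) E) : Prop :=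
  [/\ linear nabla,
      forall (a : A) (s : E),
        nabla (a *> s) = tmul (dga_d D a) s + a *> nabla s
    & forall (s : E) (a : A),
        nabla (s <* a) = nabla s <* a + sigma (tmul s (dga_d D a))].

(* The pair (s, w) is s + w in the direct sum. On the summand
   Omega^1 (x)_A E the bullet actions are those of the tensor product, see
   [lact_tmul] and [ract_tmul].                                           *)
Definition jet1 : biaction A :=
  @Biaction k A (E * tensor (Omega1 D) E)%type
    (fun a x => (a *> x.1, tmul (dga_d D a) x.1 + a *> x.2))
    (fun x a => (x.1 <* a, sigma (tmul x.1 (dga_d D a)) + x.2 <* a)).

Definition jet1_incl (w : tensor (Omega1 D) E) : jet1 := (0, w).

Definition jet1_proj (x : jet1) : E := x.1.

Definition jet1_prolong (nabla : E -> tensor (Omega1 D) E) (s : E) : jet1 :=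
  (s, nabla s).

End Jets.

Arguments jet1_proj {k A D E} sigma x.

(* Main.v *)
Require Import Defs.
From HB Require Import structures.
From mathcomp Require Import all_boot all_algebra.
From mathcomp Require Import boolp classical_sets functions.

(** The bullet actions on [E + Omega^1 (x)_A E] are triangular: on each summand
    they restrict to the given actions, and the only new terms,
    [l a s = da (x) s] and [r s a = sigma (s (x) da)], go from [E] to
    [Omega^1 (x)_A E].  Each bimodule axiom therefore holds on the diagonal and
    asks one identity of [l] and [r], as for any extension of bimodules given
    by a cocycle ([extension_bimodule]).  Associativity of the left action asks
    for [d(ab) (x) s = da (x) bs + a (db (x) s)], which is the Leibniz rule
    together with the balancedness of the tensor product; for the right action
    the same computation is pushed through the bimodule map [sigma]; and the
    two actions commute because [sigma (as (x) db) = a sigma (s (x) db)].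
    The exactness of the sequence is that of a direct sum.

    A section of the projection is a map [s |-> (s, nabla s)] for exactly one
    [nabla], and comparing second components turns linearity, left and right
    equivariance of the section into the three conditions that define a
    bimodule connection with braiding [sigma]: the terms [l] and [r] of the
    bullet actions are the inhomogeneous terms of the two Leibniz rules. *)

Local Open Scope ring_scope.
Local Open Scope bimodule_scope.

Import GRing.Theory.

Set Implicit Arguments.
Unset Strict Implicit.
Unset Printing Implicit Defensive.

Section Extension.
Variables (k : fieldType) (A : algType k) (E N : bimodule A).
Variables (l : A -> E -> N) (r : E -> A -> N).

Definition extension : biaction A :=
  @Biaction k A (E * N)%type
    (fun a x => (a *> x.1, l a x.1 + a *> x.2))
    (fun x a => (x.1 <* a, r x.1 a + x.2 <* a)).

(** The three identities say that [l] and [r] are Hochschild 1-cocycles with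
    values in maps [E -> N], compatible with each other.  Unitality comes for
    free, since a cocycle vanishes at 1. *)
Lemma extension_bimodule :
  (forall a, linear (l a)) -> (forall s, linear (l^~ s)) ->
  (forall a, linear (r^~ a)) -> (forall s, linear (r s)) ->
  (forall a b s, l (a * b) s = l a (b *> s) + a *> l b s) ->
  (forall s a b, r s (a * b) = r s a <* b + r (s <* a) b) ->
  (forall a s b, l a s <* b + r (a *> s) b = l a (s <* b) + a *> r s b) ->
  is_bimodule extension.
Proof.
move=> ll ll' rl rl' lM rM lrM.
have EP := bimoduleP E; have NP := bimoduleP N.
have l1 s : l 1 s = 0.
  apply: (addrI (l 1 s)); rewrite addr0 -[in RHS](mulr1 1) lM.
  by rewrite (lact1 EP) (lact1 NP).
have r1 s : r s 1 = 0.
  apply: (addrI (r s 1)); rewrite addr0 -[in RHS](mulr1 1) rM.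
  by rewrite (ract1 EP) (ract1 NP).
split.
- move=> a c [s w] [t v]; congr pair; first exact: (lact_linear EP).
  by rewrite /= ll (lact_linear NP) scalerDr addrACA.
- move=> [s w] c a b; congr pair; first exact: (lact_linearl EP).
  by rewrite /= ll' (lact_linearl NP) scalerDr addrACA.
- move=> [s w]; congr pair; first exact: (lact1 EP).
  by rewrite /= l1 add0r (lact1 NP).
- move=> a b [s w]; congr pair; first exact: (lactA EP).
  by rewrite /= lM (lactA NP) (linear_D (lact_linear NP a)) addrA.
- move=> a c [s w] [t v]; congr pair; first exact: (ract_linear EP).
  by rewrite /= rl (ract_linear NP) scalerDr addrACA.
- move=> [s w] c a b; congr pair; first exact: (ract_linearr EP).
  by rewrite /= rl' (ract_linearr NP) scalerDr addrACA.
- move=> [s w]; congr pair; first exact: (ract1 EP).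
  by rewrite /= r1 add0r (ract1 NP).
- move=> [s w] a b; congr pair; first exact: (ractA EP).
  rewrite /= rM (ractA NP) (linear_D (ract_linear NP b)) addrA.
  by rewrite [r (s <* a) b + _]addrC.
- move=> a [s w] b; congr pair; first exact: (lractA EP).
  rewrite /= (linear_D (ract_linear NP b)) (linear_D (lact_linear NP a)).
  by rewrite addrCA addrA lrM (lractA NP) addrA.
Qed.

Lemma extension_short_exact :
  (forall a, linear (l a)) -> (forall a, linear (r^~ a)) ->
  is_bimodule extension ->
  is_short_exact (fun w : N => (0, w) : extension) (fun x : extension => x.1).
Proof.
move=> ll rl extP.
have lin0 (U V : lmodType k) (f : U -> V) : linear f -> f 0 = 0.
  by move=> fl; rewrite -(scale0r 0) (linear_Z fl) !scale0r.
have [EP NP] := (bimoduleP E, bimoduleP N).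
split=> //.
- split; split=> //.
  + by move=> c u v; congr pair; rewrite /= scaler0 addr0.
  + move=> a w; congr pair; rewrite /= ?(lin0 _ _ _ (lact_linear EP a)) //.
    by rewrite (lin0 _ _ _ (ll a)) add0r.
  + move=> w a; congr pair; rewrite /= ?(lin0 _ _ _ (ract_linear EP a)) //.
    by rewrite (lin0 _ _ _ (rl a)) add0r.
- by move=> u v [].
- by move=> [s w]; split=> [/= -> | [v []]] //; exists w.
- by move=> s; exists (s, 0).
Qed.

(** The first components of the three conditions on [s |-> (s, f s)] are
    trivial: only the second ones constrain [f]. *)
Lemma extension_section_bimodule_mapP (f : E -> N) :
  is_bimodule_map (fun s => (s, f s) : extension) <->
  [/\ linear f,
      forall a s, f (a *> s) = l a s + a *> f s
    & forall s a, f (s <* a) = f s <* a + r s a].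
Proof.
split=> -[fl fL fR]; split.
- by move=> c s t; have /(congr1 snd) := fl c s t.
- by move=> a s; have /(congr1 snd) := fL a s.
- by move=> s a; have /(congr1 snd) /= := fR s a; rewrite addrC.
- by move=> c s t; congr pair; exact: fl.
- by move=> a s; congr pair; exact: fL.
- by move=> s a; congr pair; rewrite /= fR addrC.
Qed.

End Extension.

Section Derivation.
Variables (k : fieldType) (A : algType k) (D : dga A).

Lemma dga_d_linear : linear (dga_d D).
Proof.
move=> c a b; apply: val_inj; rewrite [RHS](of_val_linear c (dga_d D a)).
rewrite [LHS]/(dg_d D (dg_inj D (c *: a + b))) (linearP (dg_inj D)).
exact: (linearP (dg_d D)).
Qed.

(** The sign of the graded Leibniz rule is trivial on degree zero. *)
Lemma dga_d_mul (a b : A) : dga_d D (a * b) = dga_d D a <* b + a *> dga_d D b.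
Proof.
have a0 : dg_inj D a \in dg_deg D 0%N by apply/dg_deg0; exists a.
apply: val_inj; rewrite [RHS](linear_D (@of_val_linear _ _ D)).
have := dg_leibniz (dg_inj D b) a0; rewrite -rmorphM expr0 mul1r.
exact.
Qed.

End Derivation.

Section Jets.
Variables (k : fieldType) (A : algType k) (D : dga A) (E : bimodule A).
Variable sigma : tensor E (Omega1 D) -> tensor (Omega1 D) E.
Let d := dga_d D.

Lemma jet1_lterm_linear (a : A) :
  linear (fun s : E => tmul (d a) s).
Proof. by move=> c s t; rewrite tmulDr tmulZr. Qed.

Lemma jet1_rterm_linear (a : A) :
  linear sigma -> linear (fun s : E => sigma (tmul s (d a))).
Proof. by move=> sl c s t; rewrite tmulDl tmulZl sl. Qed.

(** Balancedness of the two tensor products turns the Leibniz rule into the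
    two cocycle identities. *)
Lemma jet1_bimodule : is_bimodule_map sigma -> is_bimodule (jet1 sigma).
Proof.
move=> [sl sL sR].
apply: (@extension_bimodule k A E (tensor (Omega1 D) E)
  (fun a s => tmul (d a) s) (fun s a => sigma (tmul s (d a)))).
- exact: jet1_lterm_linear.
- by move=> s c a b; rewrite /d dga_d_linear tmulDl tmulZl.
- by move=> a; exact: jet1_rterm_linear.
- by move=> s c a b; rewrite /d dga_d_linear tmulDr tmulZr sl.
- by move=> a b s; rewrite /d dga_d_mul tmulDl tmul_balanced lact_tmul.
- move=> s a b; rewrite /d dga_d_mul tmulDr (linear_D sl) -ract_tmul sR.
  by rewrite tmul_balanced.
- by move=> a s b; rewrite ract_tmul -lact_tmul sL.
Qed.

End Jets.

Theorem proposition5p1 (k : fieldType) (A : algType k) (D : dga A)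
    (E : bimodule A) (sigma : tensor E (Omega1 D) -> tensor (Omega1 D) E)
    (sigma_bimod : is_bimodule_map sigma) :
  (is_bimodule (jet1 sigma) /\
   is_short_exact (jet1_incl sigma) (jet1_proj sigma)) /\
  set_bij
    [set nabla : E -> tensor (Omega1 D) E
      | is_bimodule_connection sigma nabla]%classic
    [set j : E -> jet1 sigma
      | is_splitting (jet1_proj sigma) j]%classic
    (jet1_prolong sigma).
Proof.
have jetP := jet1_bimodule sigma_bimod.
have prolongP nabla : is_bimodule_map (jet1_prolong sigma nabla) <->
    is_bimodule_connection sigma nabla.
  exact: extension_section_bimodule_mapP.
split.
  split=> //; apply: (@extension_short_exact k A E (tensor (Omega1 D) E)
    (fun a s => tmul (dga_d D a) s) (fun s a => sigma (tmul s (dga_d D a)))).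
  - exact: jet1_lterm_linear.
  - by have [sl _ _] := sigma_bimod; move=> a; exact: jet1_rterm_linear.
  - exact: jetP.
split.
- by move=> nabla /= /prolongP.
- move=> nabla nabla' _ _ eqj; apply/funext => s.
  by have /(congr1 snd) := congr1 (@^~ s) eqj.
- move=> j [jb js].
  have ej : jet1_prolong sigma (fun s => (j s).2) = j.
    apply/funext => s; rewrite [RHS]surjective_pairing.
    by congr pair; rewrite -[LHS](js s).
  by exists (fun s => (j s).2) => //=; apply/prolongP; rewrite ej.
Qed.
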